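(* Let $D\in\mathbb{C}^{n\times n}$ be a diagonal matrix of the form $D=\begin{bmatrix}D_1&0\\ 0&D_2\end{bmatrix}$ with $D_1=\lambda_1 I$, and let $$gap=\min_{\lambda\in\Lambda(D_2)}|\lambda_1-\lambda|>0 .$$ Let $E$ and $B$ be partitioned conformally with $D$ as $$E=\begin{bmatrix}0&E_1\\ E_2&0\end{bmatrix},\qquad B=\begin{bmatrix}0&B_1\\ B_2&0\end{bmatrix},$$ where $E_1=D_1B_1-B_1D_2$ and $E_2=D_2B_2-B_2D_1$, and assume $\|E\|<gap$. For $t\in[0,1]$ let $\mathcal{X}_t$ be the column span of $\begin{bmatrix}I\\ -tB_2\end{bmatrix}$. Then for every $t\in[0,1]$ and every right eigenvector $x_i(t)$ of $D+tE$ with $\|x_i(t)\|=1$ relative to a perturbed eigenvalue $\lambda_i(t)$ of the upper-left block of $D$, $$\|\Pi_{\mathcal{X}_t^{\perp}}x_i(t)\|\le\frac{\|B_2\|\,\|E\|}{gap-\|E\|},$$ where $\Pi_{\mathcal{X}_t^{\perp}}$ is the orthogonal projection onto $\mathcal{X}_t^\perp$.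
   Context: $\|\cdot\|$ is the spectral norm for matrices and the Euclidean norm for vectors; $\Lambda(\cdot)$ denotes the spectrum. The eigenvalues of $D_2$ may be multiple. A ''perturbed eigenvalue of the upper-left block'' is an eigenvalue $\lambda_i(t)$ of $D+tE$ associated with $\lambda_1$ in the sense of the Bauer–Fike theorem, i.e. $|\lambda_i(t)-\lambda_1|\le t\|E\|$. *)

(* Defs.v *)
From mathcomp Require Import all_boot all_order all_algebra.
From mathcomp Require Import boolp classical_sets reals.
From mathcomp Require Import sesquilinear spectral.
From mathcomp Require Import complex.

Set Implicit Arguments.
Unset Strict Implicit.
Unset Printing Implicit Defensive.

Import Order.TTheory GRing.Theory Num.Theory.

Local Open Scope classical_set_scope.
Local Open Scope ring_scope.
Local Open Scope complex_scope.

(* The modulus of a complex number is the real-valued [Normc.normc], since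
   [`|z|] lives in [R[i]]. *)

Definition enorm (R : realType) n (x : 'cV[R[i]]_n) : R :=
  Num.sqrt (\sum_i Normc.normc (x i 0) ^+ 2).

(* Operator norm induced by [enorm]. If A has no columns, there is no unit
   vector, and [sup set0 = 0]. *)
Definition spnorm (R : realType) m n (A : 'M[R[i]]_(m, n)) : R :=
  sup [set enorm (A *m x) | x in [set x : 'cV[R[i]]_n | enorm x = 1]].

(* [eigenvalue] refers to left (row) eigenvectors; for a square matrix over a
   field this gives the same set as right eigenvectors. *)
Definition spectrum (R : realType) n (A : 'M[R[i]]_n) : set R[i] :=
  [set l | eigenvalue A l].

Definition right_eigenvector (R : realType) n (A : 'M[R[i]]_n) (l : R[i])
    (x : 'cV[R[i]]_n) : Prop :=
  x != 0 /\ A *m x = l *: x.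

Definition is_min (R : realType) (S : set R) (m : R) : Prop :=
  S m /\ lbound S m.

(* Row space of the result: the orthogonal complement, for the standard
   Hermitian product [dotmx], of the row space of A. *)
Definition orthocompl (R : realType) m n (A : 'M[R[i]]_(m, n)) : 'M[R[i]]_n :=
  orthomx Num.conj (mx_of_hermitian (hermitian1mx n)) A.

(* Matrix of the orthogonal projection of column vectors onto the orthogonal
   complement of the column span of M. The library represents subspaces as row
   spaces and lets [proj_ortho U] act on rows from the right, hence the two
   transpositions. *)
Definition proj_colspan_perp (R : realType) m n (M : 'M[R[i]]_(n, m)) :
    'M[R[i]]_n :=
  (proj_ortho (orthocompl M^T))^T.

(* Main.v *)
Require Import Defs.
From mathcomp Require Import all_boot all_order all_algebra.
From mathcomp Require Import boolp classical_sets reals.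
From mathcomp Require Import sesquilinear spectral.
From mathcomp Require Import complex.
From mathcomp Require Import ring.

Import Order.TTheory GRing.Theory Num.Theory.

Local Open Scope classical_set_scope.
Local Open Scope ring_scope.
Local Open Scope complex_scope.

(* Write the eigenvector as x = (u, v) and put w = v + t B_2 u, so that
   x = (u, - t B_2 u) + (0, w) and the projection of x is that of (0, w), hence
   of norm at most |w|. Since E_2 = (D_2 - l1) B_2, the lower block of the
   eigenvector equation becomes (D_2 - li) w = t (l1 - li) B_2 u. The matrix
   D_2 is diagonal with |d_j - li| >= gap - |l1 - li| >= gap - |E|, and
   |l1 - li| <= t |E| <= |E|, which bounds w entrywise by B_2 u. *)

Section Norms.
Import Normc.
Set Implicit Arguments.
Unset Strict Implicit.

Lemma normc_ge0 (R : rcfType) (z : R[i]) : 0 <= normc z.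
Proof. by case: z => a b; rewrite sqrtr_ge0. Qed.

Lemma normc_real (R : rcfType) (a : R) : 0 <= a -> normc a%:C = a.
Proof. by move=> a0; rewrite /= expr0n addr0 sqrtr_sqr ger0_norm. Qed.

Lemma normc_sum (R : rcfType) (I : Type) (r : seq I) (P : pred I) (F : I -> R[i]) :
  normc (\sum_(i <- r | P i) F i) <= \sum_(i <- r | P i) normc (F i).
Proof.
elim/big_rec2: _ => [|i y1 y2 _ le12]; first by rewrite normc0.
exact: le_trans (le_normcD _ _) (lerD (lexx _) le12).
Qed.

Section EuclideanNorm.
Context {R : realType}.

Lemma enorm_ge0 n (x : 'cV[R[i]]_n) : 0 <= enorm x.
Proof. exact: sqrtr_ge0. Qed.

Lemma enorm_sqr n (x : 'cV[R[i]]_n) : enorm x ^+ 2 = \sum_i normc (x i 0) ^+ 2.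
Proof. by rewrite sqr_sqrtr // sumr_ge0 // => i _; rewrite sqr_ge0. Qed.

Lemma normc_le_enorm n (x : 'cV[R[i]]_n) i : normc (x i 0) <= enorm x.
Proof.
rewrite -(@ler_pXn2r _ 2) // ?nnegrE ?normc_ge0 ?enorm_ge0 // enorm_sqr.
by rewrite (bigD1 i) //= lerDl sumr_ge0 // => j _; rewrite sqr_ge0.
Qed.

Lemma enorm_eq0 n (x : 'cV[R[i]]_n) : enorm x = 0 -> x = 0.
Proof.
move=> x0; apply/colP => i; rewrite mxE; apply: eq0_normc; apply/eqP.
by rewrite eq_le normc_ge0 andbT -x0 normc_le_enorm.
Qed.

(** Entrywise domination passes to the norm. It serves both the bound of [w] by [B2 *m u] and, with
    [c = 1], the boundedness of the set defining [spnorm]. *)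
Lemma enorm_le_scale n (c : R) (x y : 'cV[R[i]]_n) : 0 <= c ->
  (forall i, normc (x i 0) <= c * normc (y i 0)) -> enorm x <= c * enorm y.
Proof.
move=> c0 xy; rewrite -(@ler_pXn2r _ 2) // ?nnegrE ?mulr_ge0 ?enorm_ge0 //.
rewrite exprMn !enorm_sqr mulr_sumr ler_sum // => i _; rewrite -exprMn.
by rewrite ler_pXn2r ?nnegrE ?mulr_ge0 ?normc_ge0.
Qed.

Lemma enormZ n (a : R[i]) (x : 'cV[R[i]]_n) : enorm (a *: x) = normc a * enorm x.
Proof.
apply/eqP; rewrite -(@eqrXn2 _ 2) ?mulr_ge0 ?enorm_ge0 ?normc_ge0 //.
rewrite exprMn !enorm_sqr mulr_sumr; apply/eqP/eq_bigr => i _.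
by rewrite mxE normcM exprMn.
Qed.

Lemma enorm0 n : enorm (0 : 'cV[R[i]]_n) = 0.
Proof. by rewrite -(scale0r 0) enormZ normc0 mul0r. Qed.

Lemma enorm_usubmx m n (x : 'cV[R[i]]_(m + n)) : enorm (usubmx x) <= enorm x.
Proof.
rewrite -(@ler_pXn2r _ 2) // ?nnegrE ?enorm_ge0 // !enorm_sqr big_split_ord /=.
under eq_bigr do rewrite mxE.
by rewrite lerDl sumr_ge0 // => i _; rewrite sqr_ge0.
Qed.

Lemma enorm_col_mx0 m n (x : 'cV[R[i]]_n) :
  enorm (col_mx (0 : 'cV_m) x) = enorm x.
Proof.
rewrite /enorm big_split_ord /= big1 ?add0r => [|i _].
  by under eq_bigr do rewrite col_mxEd.
by rewrite col_mxEu mxE normc0 expr0n.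
Qed.

(** Bridge to the Hermitian product [dotmx], which acts on rows and takes values in [R[i]]; hence
    the transposes and the cast. *)
Lemma enorm_dotmx n (x : 'cV[R[i]]_n) : (enorm x ^+ 2)%:C = dotmx x^T x^T.
Proof.
rewrite enorm_sqr dotmxE mxE rmorph_sum; apply: eq_bigr => i _.
by rewrite !mxE -normCK rmorphXn.
Qed.

(** Pythagoras: the projection [z] of [y] is orthogonal to [y - z], so the squared norm of [y] is
    that of [z] plus a nonnegative term. *)
Lemma enorm_proj_ortho m n (U : 'M[R[i]]_(m, n)) (x : 'cV[R[i]]_n) :
  enorm ((proj_ortho U)^T *m x) <= enorm x.
Proof.
rewrite -(@ler_pXn2r _ 2) // ?nnegrE ?enorm_ge0 // -lecR !enorm_dotmx.
rewrite trmx_mul trmxK; set y := x^T; set z := y *m _.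
have zP : dotmx z (y - z) = 0.
  apply/eqP; rewrite -orthomxE orthomx_sym.
  apply: submx_trans (proj_ortho_compl_sub U y) _.
  by rewrite submx_ortho proj_ortho_sub.
have -> : dotmx y y = dotmx z z + dotmx (y - z) (y - z).
  (* The expansion of the square leaves a cross term plus its conjugate; both vanish by [zP]. *)
  rewrite -[y in LHS](subrK z) addrC (dnormD (@dotmx _ n)) /=.
  have zP2 : dotmx z (y - z) + (dotmx z (y - z))^* = 0.
    by rewrite zP rmorph0 addr0.
  by rewrite [X in _ + X]zP2 addr0.
by rewrite lerDl (dnorm_ge0 (@dotmx _ n)).
Qed.

(** The projection kills the orthogonal complement of its range; here that is a double complement,
    which [ortho_id] identifies with the span of [M] itself. *)
Lemma proj_colspan_perp_mul0 m n (M : 'M[R[i]]_(n, m)) :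
  proj_colspan_perp M *m M = 0.
Proof.
apply: trmx_inj; rewrite trmx_mul trmxK trmx0.
by apply: proj_ortho_0; rewrite ortho_id.
Qed.

(** The entries of a unit vector have modulus at most 1, so each entry of [A *m x] is bounded by the
    sum of the moduli in that row of [A]. Boundedness is what makes [sup] an actual upper bound. *)
Lemma spnorm_has_ubound m n (A : 'M[R[i]]_(m, n)) :
  has_ubound [set enorm (A *m x) | x in [set x : 'cV[R[i]]_n | enorm x = 1]].
Proof.
exists (enorm (\col_i (\sum_j normc (A i j))%:C)) => _ [x /= x1 <-].
rewrite -[leRHS]mul1r; apply: enorm_le_scale => // i.
rewrite !mxE mul1r normc_real ?sumr_ge0 // => [|j _]; last exact: normc_ge0.
apply: le_trans (normc_sum _ _ _) _; apply: ler_sum => j _.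
rewrite normcM -[leRHS]mulr1 ler_wpM2l ?normc_ge0 //.
by rewrite -x1 normc_le_enorm.
Qed.

Lemma spnorm_ge0 m n (A : 'M[R[i]]_(m, n)) : 0 <= spnorm A.
Proof.
rewrite /spnorm; set S := image _ _.
(* If there is no unit vector, [sup] takes its default value 0; otherwise any member of the set is a
   nonnegative lower bound for [sup]. *)
have [->|/set0P [y Sy]] := eqVneq S set0; first by rewrite sup0.
have [x _ xy] := Sy; apply: le_trans (enorm_ge0 (A *m x)) _; rewrite xy.
exact: ub_le_sup (spnorm_has_ubound A) _ Sy.
Qed.

Lemma enorm_mulmx m n (A : 'M[R[i]]_(m, n)) (x : 'cV[R[i]]_n) :
  enorm (A *m x) <= spnorm A * enorm x.
Proof.
have [/enorm_eq0 ->|x0] := eqVneq (enorm x) 0.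
  by rewrite mulmx0 !enorm0 mulr0.
have px : 0 < enorm x by rewrite lt_neqAle eq_sym x0 enorm_ge0.
have V0 : 0 <= (enorm x)^-1 by rewrite invr_ge0 enorm_ge0.
(* For nonzero [x], dividing by its norm yields a unit vector, to which the supremum applies. *)
rewrite -ler_pdivrMr // mulrC -[X in X * _]normc_real // -enormZ scalemxAr.
apply: ub_le_sup; first exact: spnorm_has_ubound.
by exists ((enorm x)^-1%:C *: x) => //=; rewrite enormZ normc_real // mulVf.
Qed.

End EuclideanNorm.

Lemma mulmx_diag_entry (R : pzSemiRingType) m n (A : 'M[R]_m) (B : 'M_(m, n)) i j :
  is_diag_mx A -> (A *m B) i j = A i i * B i j.
Proof.
move=> /is_diag_mxP dA; rewrite mxE (bigD1 i) //= big1 ?addr0 // => k ki.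
by rewrite dA ?mul0r // eq_sym.
Qed.

(** The i-th standard row vector is a left eigenvector. This puts the diagonal entries of [D2] in
    its spectrum, so that [gap] bounds their distance to [l1]. *)
Lemma eigenvalue_diag (F : fieldType) n (A : 'M[F]_n) i :
  is_diag_mx A -> eigenvalue A (A i i).
Proof.
move=> /is_diag_mxP dA; apply/eigenvalueP; exists (delta_mx 0 i).
  apply/rowP => j; rewrite -rowE !mxE /=.
  have [<-|ij] := eqVneq i j; first by rewrite mulr1.
  by rewrite mulr0 dA.
by apply/eqP => /matrixP/(_ 0 i)/eqP; rewrite !mxE !eqxx oner_eq0.
Qed.

End Norms.

Theorem theorem5p1 (R : realType) (p q : nat) (hp : (0 < p)%N) (hq : (0 < q)%N)
  (l1 : R[i])
  (D E B : 'M[R[i]]_(p + q))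
  (D1 : 'M[R[i]]_p) (D2 : 'M[R[i]]_q)
  (E1 B1 : 'M[R[i]]_(p, q)) (E2 B2 : 'M[R[i]]_(q, p))
  (gap : R)
  (hDdiag : is_diag_mx D)
  (hD : D = block_mx D1 0 0 D2)
  (hD1 : D1 = l1%:M)
  (hgap : is_min [set Normc.normc (l1 - l) | l in spectrum D2] gap)
  (hgap0 : 0 < gap)
  (hE : E = block_mx 0 E1 E2 0)
  (hB : B = block_mx 0 B1 B2 0)
  (hE1 : E1 = D1 *m B1 - B1 *m D2)
  (hE2 : E2 = D2 *m B2 - B2 *m D1)
  (hEgap : spnorm E < gap) :
  forall t : R, 0 <= t <= 1 ->
  forall (li : R[i]) (x : 'cV[R[i]]_(p + q)),
    spectrum (D + t%:C *: E) li ->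
    Normc.normc (li - l1) <= t * spnorm E ->
    right_eigenvector (D + t%:C *: E) li x ->
    enorm x = 1 ->
    enorm (proj_colspan_perp (col_mx 1%:M (- (t%:C *: B2))) *m x)
      <= spnorm B2 * spnorm E / (gap - spnorm E).
Proof.
move=> t /andP[t0 t1] li x _ hli [_ hx] x1.
pose u := usubmx x; pose v := dsubmx x.
have hv : D2 *m v + t%:C *: (E2 *m u) = li *: v.
  move: hx; rewrite -[x in LHS]vsubmxK -[x in RHS]vsubmxK hD hE.
  rewrite scale_block_mx add_block_mx mul_block_col scale_col_mx.
  by case/eq_col_mx => _ <-; rewrite scaler0 !add0r addr0 -scalemxAl addrC.
pose w := v + t%:C *: (B2 *m u).
have xE : x = col_mx 1%:M (- (t%:C *: B2)) *m u + col_mx 0 w.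
  rewrite mul_col_mx add_col_mx mul1mx addr0 mulNmx -scalemxAl addrC.
  by rewrite /w addrK vsubmxK.
have dD2 : is_diag_mx D2.
  by move: hDdiag; rewrite hD is_diag_block_mx // => /and4P[].
have hw : D2 *m w - li *: w = (t%:C * (l1 - li)) *: (B2 *m u).
  have E2u : E2 *m u = D2 *m (B2 *m u) - l1 *: (B2 *m u).
    by rewrite hE2 hD1 mulmxBl mul_mx_scalar -scalemxAl mulmxA.
  rewrite /w mulmxDr scalerDr -hv -scalemxAr E2u.
  (* With the three vectors generalized, the identity is a polynomial one in each coordinate. *)
  move: (D2 *m v) (D2 *m (B2 *m u)) (B2 *m u) => a b c.
  by apply/colP => j; rewrite !mxE; ring.
have E0 := spnorm_ge0 E.
have gE : 0 < gap - spnorm E by rewrite subr_gt0.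
have hliE : Normc.normc (l1 - li) <= spnorm E.
  rewrite -normcN opprB (le_trans hli) // -[leRHS]mul1r.
  exact: ler_wpM2r.
have hd j : gap - spnorm E <= Normc.normc (D2 j j - li).
  rewrite lerBlDr.
  have : gap <= Normc.normc (l1 - D2 j j).
    by apply: hgap.2; exists (D2 j j) => //; exact: eigenvalue_diag.
  move=> /le_trans; apply.
  (* Reverse triangle inequality, with [li] inserted between [l1] and the diagonal entry. *)
  have -> : l1 - D2 j j = (l1 - li) - (D2 j j - li) by ring.
  by rewrite addrC (le_trans (le_normcD _ _)) // normcN lerD.
rewrite [x in leLHS]xE mulmxDr mulmxA proj_colspan_perp_mul0 mul0mx add0r.
apply: le_trans (enorm_proj_ortho _ _) _; rewrite enorm_col_mx0.
have c0 : 0 <= spnorm E / (gap - spnorm E) by rewrite divr_ge0 // ltW.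
have wB : enorm w <= spnorm E / (gap - spnorm E) * enorm (B2 *m u).
  (* Clearing the positive denominator leaves, for each [j], [gap - spnorm E] times the modulus of
     [w j 0] to be bounded by [spnorm E] times that of [(B2 *m u) j 0]. *)
  apply: enorm_le_scale => // j; rewrite mulrAC ler_pdivlMr // mulrC.
  apply: le_trans (ler_wpM2r (normc_ge0 _) (hd j)) _.
  rewrite -Normc.normcM.
  have -> : (D2 j j - li) * w j 0 = t%:C * (l1 - li) * (B2 *m u) j 0.
    move/colP/(_ j): hw; rewrite [X in _ = X -> _]mxE => <-.
    rewrite [RHS]mxE mulmx_diag_entry // [X in _ = _ + X]mxE.
    by rewrite [(li *: w) j 0]mxE mulrBl.
  rewrite !Normc.normcM normc_real //; apply: ler_wpM2r; first exact: normc_ge0.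
  by rewrite -[leRHS]mul1r ler_pM // normc_ge0.
apply: le_trans wB _; rewrite -[leRHS]mulrA [leRHS]mulrC.
apply: ler_wpM2l => //.
(* The block [u] of the unit vector [x] has norm at most 1. *)
apply: le_trans (enorm_mulmx _ _) _; rewrite -[leRHS]mulr1.
apply: ler_wpM2l; first exact: spnorm_ge0.
by rewrite -x1 enorm_usubmx.
Qed.
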